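(* Let $A=\mathbb{R}[p_2,p_3,\ldots]$, let $I\subset A$ be the ideal generated by $1-p_2$, and let $T=(\Sigma\cap A)+I$, where $\Sigma$ is the set of all any-dimensional sums of squares. Then $$\{(\varphi(p_2),\varphi(p_3),\ldots)\mid\varphi\in\mathcal{K}_T\}=\operatorname{cl}\{(p_2(x),p_3(x),\ldots)\mid x\in\mathbb{R}^\infty,\ \|x\|_2=1\},$$ where the closure is taken with respect to the product topology on $\mathbb{R}^{\mathbb{N}}$.
   Context: For $k\geq 1$ let $p_k=\sum_{i=1}^\infty X_i^k$ be the $k$-th power sum function in countably many variables; the $p_k$ are algebraically independent. $\Lambda=\mathbb{R}[p_1,p_2,\ldots]$ is the ring of symmetric functions and $f^{(n)}=f(X_1,\ldots,X_n,0,0,\ldots)$ denotes the truncation of $f\in\Lambda$ to $n$ variables. $\Sigma\subset\Lambda$ is the set of all $f\in\Lambda$ such that, for every positive integer $n$, $f^{(n)}$ is a sum of squares of polynomials in $\mathbb{R}[X_1,\ldots,X_n]$. $\mathcal{K}_T$ is the set of all unitary ring homomorphisms $\varphi:A\to\mathbb{R}$ with $\varphi(T)\subset[0,\infty)$. $\mathbb{R}^\infty$ is the set of real sequences with only finitely many non-zero entries, and $\|x\|_2=(\sum_i x_i^2)^{1/2}$. *)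

(* Defs.v *)
From HB Require Import structures.
From mathcomp Require Import all_boot all_order all_algebra finmap.
From mathcomp Require Import all_classical all_reals all_analysis.
(* The notations of monalg and mpoly clash with those of mathcomp-analysis. *)
From mathcomp.multinomials Require Import -(notations) monalg mpoly.

Set Implicit Arguments.
Unset Strict Implicit.
Unset Printing Implicit Defensive.

Import Order.TTheory GRing.Theory Num.Theory.
Import numFieldNormedType.Exports.

Local Open Scope classical_set_scope.
Local Open Scope ring_scope.

(* The polynomial ring R[y_0, y_1, ...] in countably many indeterminates:
   finite R-combinations of finitely supported exponent functions nat -> nat. *)
Notation cpoly R := (malg (cmonom nat) R).

Definition cvar (R : realType) (i : nat) : cpoly R := mkmalgU (ucm i) 1.

(* The R-algebra morphism that sends each indeterminate y_i to v i. *)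
Definition ceval (R : realType) (S : comAlgType R) (v : nat -> S)
    (f : cpoly R) : S :=
  monalg.mmap (in_alg S)
    (fun m : cmonom nat => \prod_(i <- finsupp m) v i ^+ m i) f.

(* As p_1, p_2, ... are algebraically independent, Lambda = R[p_1, p_2, ...]
   is the polynomial ring in which y_i stands for p_(i+1), and
   A = R[p_2, p_3, ...] the polynomial ring in which y_i stands for p_(i+2). *)
Notation Lambda R := (cpoly R).
Notation symA R := (cpoly R).

(* pL i is p_(i+1) in Lambda; pA i is p_(i+2) in A. *)
Definition pL (R : realType) (i : nat) : Lambda R := cvar R i.
Definition pA (R : realType) (i : nat) : symA R := cvar R i.

(* The inclusion of A in Lambda: p_(i+2) is pA i in A and pL i.+1 in Lambda. *)
Definition inclA (R : realType) : symA R -> Lambda R :=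
  ceval (fun i => pL R i.+1).

Definition psum (R : realType) (n k : nat) : mpoly n R :=
  \sum_(i < n) mpolyX R (mnm1 i) ^+ k.

(* f |-> f^(n) *)
Definition trunc (R : realType) (n : nat) : Lambda R -> mpoly n R :=
  ceval (fun i => psum R n i.+1).

Definition is_sos (S : pzRingType) (f : S) : Prop :=
  exists s : seq S, f = \sum_(g <- s) g ^+ 2.

Definition Sigma (R : realType) : set (Lambda R) :=
  [set f | forall n : nat, (0 < n)%N -> is_sos (trunc n f)].
Arguments Sigma R : clear implicits.

Definition idealI (R : realType) : set (symA R) :=
  [set g * (1 - pA R 0) | g in [set: symA R]].
Arguments idealI R : clear implicits.

Definition coneT (R : realType) : set (symA R) :=
  [set s + h | s in @inclA R @^-1` Sigma R & h in idealI R].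
Arguments coneT R : clear implicits.

(* A ring morphism into R is automatically R-linear, so linearity over R is
   deliberately not required. *)
Definition posK (R : realType) (T : set (symA R)) :
    set {rmorphism symA R -> R} :=
  [set phi : {rmorphism symA R -> R} | forall f, T f -> 0 <= phi f].

(* R^infinity: the real sequences with finitely many nonzero entries. *)
Notation finseq R := {fsfun nat -> R with 0}.

(* The power sum p_k(x), for k > 0. *)
Definition peval (R : realType) (k : nat) (x : finseq R) : R :=
  \sum_(i <- finsupp x) x i ^+ k.

Definition norm2 (R : realType) (x : finseq R) : R :=
  Num.sqrt (\sum_(i <- finsupp x) x i ^+ 2).

(* Main.v *)
Require Import Defs.
From HB Require Import structures.
From mathcomp Require Import all_boot all_order all_algebra finmap.
From mathcomp Require Import all_classical all_reals all_analysis.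
From mathcomp.multinomials Require Import -(notations) monalg mpoly.
From mathcomp Require Import ring zify.
From mathcomp Require Import complex.

Set Implicit Arguments.
Unset Strict Implicit.
Unset Printing Implicit Defensive.

Import Order.TTheory GRing.Theory Num.Theory.
Import numFieldNormedType.Exports.

Local Open Scope classical_set_scope.
Local Open Scope ring_scope.

(** The inclusion from right to left is evaluation: a point [a] of the closure
    defines [f |-> f a], which is continuous in [a] for each fixed [f]; at the
    power sums of a unit vector with [n] coordinates an element of [Sigma] is
    the value of a sum of squares, and [1 - p_2] vanishes.

    For the converse let [phi] be positive on [T] and [a_k = phi p_k], so that
    [a_2 = 1].  By Newton's identities
    [a_2, a_3, ...] is encoded in the power series [F = sum_k e_k z^k] with
    [log F = sum_(k >= 2) (-1)^(k-1) a_k z^k / k].  A unit vector [x] gives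
    [F = prod_i (1 + x_i z) exp (- x_i z)], and the limits of such functions
    are those of the Laguerre-Polya class, recognised by their Jensen
    polynomials having real roots only.

    Newton's recursion with [p_1] replaced by [0] defines [e_k] in [A], the
    coefficients of [F]; the Jensen polynomial is
    [J_N = sum_k N (N-1) ... (N-k+1) e_k X^(N-k)], that is [F(d/dX)] applied to
    [X^N].  When [p_k] is the power sum of [n] variables [x_i], the polynomial
    [J_N] is obtained from [(X - sum_i x_i)^N] by applying the operators
    [1 + x_i d/dX].  The central observation is that the Bezoutian
    [(J(s) J'(t) - J'(s) J(t)) / (s - t)] is then a sum of terms [b(s) b(t)]
    where the coefficients of [b] are polynomials in the [x_i]
    ([sos_tower_step]).  So every value of the quadratic form of the Bezoutian
    of [J_N] is an element of [A] that belongs to [Sigma]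
    ([Sigma_bezout_form]), and its image under [phi] is nonnegative.

    By Hermite's theorem ([psd_bezout_split]) the real polynomial [phi J_N] has
    real roots [y_1, ..., y_N] only.  The numbers
    [x_i = - y_i / sqrt (N (N-1))] satisfy [sum_i x_i^2 = 1], which is the
    condition [a_2 = 1] read on the coefficients of [X^(N-1)] and [X^(N-2)], and
    their [k]-th elementary symmetric function is [phi e_k] times a factor that
    tends to [1] ([unit_points_of_split], [cvg_ffact_root_scale]).  Newton's
    recursion is continuous, so their power sums tend to the [a_k]
    ([cvg_newton]). *)

(** * Sum-of-squares certificates for Bezoutians *)

Section Kernels.
Variable S : comNzRingType.
Implicit Types (K L : nat -> nat -> S) (f q : {poly S}) (x c : S).

(** An array [K] stands for the polynomial [sum_(i, j) K i j s^i t^j] in two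
    commuting variables; multiplication by [s] or [t] shifts one index. *)
Definition shift (u : nat -> S) (i : nat) : S := if i is i'.+1 then u i' else 0.

(** [(s - t) L = (d/dt - d/ds) K].  For [K = f(s) f(t)] the array [L] is the
    Bezoutian of [f] and its derivative. *)
Definition bezout_step K L := forall i j,
  shift (fun i => L i j) i - shift (L i) j
  = j.+1%:R * K i j.+1 - i.+1%:R * K i.+1 j.

Definition sos_kernel K := exists s : seq {poly S},
  forall i j, K i j = \sum_(b <- s) b`_i * b`_j.

Definition sq_kernel f i j := f`_i * f`_j.

(** If [f] is the product of the [X - r_i], the [m]-th array is the sum of
    [f_I(s) f_I(t)] over the [m]-tuples [I] of distinct indices, where [f_I] is
    [f] without the factors indexed by [I].  Only the array for [m = 1] is
    wanted; the others are there because the step below expresses the [m]-th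
    array of the new polynomial through the arrays [m] and [m + 1] of the old. *)
Definition sos_tower f := exists K : nat -> nat -> nat -> S,
  [/\ forall i j, K 0 i j = sq_kernel f i j, forall m, sos_kernel (K m)
    & forall m, bezout_step (K m) (K m.+1)].

Lemma shift_coef f i : shift (fun i => f`_i) i = ('X * f)`_i.
Proof. by rewrite coefXM; case: i. Qed.

Lemma sos_kernelD K L : sos_kernel K -> sos_kernel L ->
  sos_kernel (fun i j => K i j + L i j).
Proof.
move=> [s Ks] [t Lt]; exists (s ++ t) => i j.
by rewrite big_cat Ks Lt.
Qed.

Lemma sos_kernelMn K n : sos_kernel K -> sos_kernel (fun i j => K i j *+ n).
Proof.
move=> sK; elim: n => [|n IHn].
  by exists [::] => i j; rewrite big_nil mulr0n.
have [s Ks] := sos_kernelD sK IHn.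
by exists s => i j; rewrite mulrS Ks.
Qed.

(** All roots coincide, so the [m]-th array has [n ^_ m] equal terms. *)
Lemma sos_tower_XsubC c n : sos_tower (('X - c%:P) ^+ n).
Proof.
exists (fun m i j => sq_kernel (('X - c%:P) ^+ (n - m)) i j *+ n ^_ m).
split=> [i j|m|m i j].
- by rewrite subn0.
- by apply: sos_kernelMn; exists [:: ('X - c%:P) ^+ (n - m)] => i j; rewrite big_seq1.
have [le_nm|lt_mn] := leqP n m.
  rewrite ffact_small ?ltnS // (eqP le_nm) /sq_kernel expr0 !coefC.
  by case: i j => [|i] [|j] /=; rewrite ?(mulr0n, mulr0, mul0r, mul0rn, subr0).
rewrite ffactnSr; set r := (n - m.+1)%N; set N := (n ^_ m)%N.
set g := ('X - c%:P) ^+ r; set G := (_ ^+ (n - m)).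
have XgE : 'X * g = G + c *: g.
  rewrite /G (_ : (n - m)%N = r.+1); last by rewrite /r; lia.
  by rewrite exprS -/g mulrBl mul_polyC subrK.
have dG l : l.+1%:R * G`_l.+1 = r.+1%:R * g`_l.
  rewrite !mulr_natl -coef_deriv /G (_ : (n - m)%N = r.+1); last by rewrite /r; lia.
  by rewrite deriv_exp derivXsubC mul1r coefMn.
have shiftE l u : shift (fun i => g`_i * u) l = (G`_l + c * g`_l) * u.
  by rewrite -coefZ -coefD -XgE -shift_coef; case: l => [|l] //=; rewrite mul0r.
have -> : shift (fun i => sq_kernel g i j *+ (N * (n - m))) i
    = shift (fun i => g`_i * (g`_j *+ (N * (n - m)))) i.
  by case: (i) => //= l; rewrite /sq_kernel mulrnAr.
have -> : shift (fun j => sq_kernel g i j *+ (N * (n - m))) j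
    = shift (fun j => g`_j * (g`_i *+ (N * (n - m)))) j.
  by case: (j) => //= l; rewrite /sq_kernel mulrnAr mulrC.
have -> : (n - m)%N = r.+1 by rewrite /r; lia.
rewrite !shiftE /sq_kernel.
transitivity ((G`_i * (r.+1%:R * g`_j) - (r.+1%:R * g`_i) * G`_j) *+ N).
  by rewrite !mulrnA; move: (g`_i) (g`_j) (G`_i) (G`_j) => *; ring.
by rewrite -!dG; ring.
Qed.

(** Write [U = (1 + x d/ds) (1 + x d/dt)], so that the new [K 0] is [U (K 0)].
    The commutator of [U] with multiplication by [s - t] is
    [x^2 (d/dt - d/ds)]; it is compensated by a multiple of the next array, and
    [U (K m) + m x^2 K (m + 1)] is again a tower.  Both terms remain sums of
    [b(s) b(t)], since [U] sends [b(s) b(t)] to the same expression in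
    [b + x b']. *)
Lemma sos_tower_step f x : sos_tower f -> sos_tower (f + x *: f^`()).
Proof.
move=> [K [K0 Ksos Kt]].
pose U (A : nat -> nat -> S) i j := A i j + x * (i.+1%:R * A i.+1 j + j.+1%:R * A i j.+1)
  + x ^+ 2 * i.+1%:R * j.+1%:R * A i.+1 j.+1.
exists (fun m i j => U (K m) i j + x ^+ 2 * K m.+1 i j *+ m); split=> [|m|m i j].
- move=> i j.
  rewrite mulr0n addr0 /U !K0 /sq_kernel !coefD !coefZ !coef_deriv; ring.
- apply: sos_kernelD.
    have [s Ks] := Ksos m; exists [seq b + x *: b^`() | b <- s] => i j.
    rewrite big_map /U !Ks !big_distrr -!big_split /= big_distrr -!big_split /=.
    apply: eq_bigr => b _; rewrite !coefD !coefZ !coef_deriv; ring.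
  apply: sos_kernelMn; have [s Ks] := Ksos m.+1; exists [seq x *: b | b <- s] => i j.
  by rewrite big_map Ks big_distrr /=; apply: eq_bigr => b _; rewrite !coefZ; ring.
move: (K m) (K m.+1) (K m.+2) (Kt m) (Kt m.+1) => A B C AB BC.
(* The goal is [U] applied to the relation between [A] and [B], plus
   [(m + 1) x^2] times the relation between [B] and [C]. *)
have lin (l1 r1 l2 r2 l3 r3 l4 r4 l5 r5 c1 c2 c3 c4 X Y : S) :
    l1 = r1 -> l2 = r2 -> l3 = r3 -> l4 = r4 -> l5 = r5 ->
    X - Y = (l1 - r1) + c1 * (l2 - r2) + c2 * (l3 - r3) + c3 * (l4 - r4) + c4 * (l5 - r5) ->
    X = Y.
  by move=> -> -> -> -> -> /eqP; rewrite !subrr !mulr0 !addr0 subr_eq0 => /eqP.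
apply: (lin _ _ _ _ _ _ _ _ _ _ (x * i.+1%:R) (x * j.+1%:R) (x ^+ 2 * i.+1%:R * j.+1%:R)
  (m.+1%:R * x ^+ 2) _ _ (AB i j) (AB i.+1 j) (AB i j.+1) (AB i.+1 j.+1) (BC i j)).
by rewrite /U; case: i j => [|i] [|j]; cbn [shift]; ring.
Qed.
End Kernels.

(** * Jensen polynomials *)

(** [(prod_x (1 + x d/dX)) (X - c)^n]. *)
Definition jensen_prod (S : comNzRingType) (n : nat) (c : S) (xs : seq S) : {poly S} :=
  foldr (fun x f => f + x *: f^`()) (('X - c%:P) ^+ n) xs.

(** Newton's identities between elementary symmetric functions [e k] and power
    sums, with [p j] in the role of the power sum of exponent [j + 1]. *)
Definition newton (S : nzRingType) (e p : nat -> S) := e 0 = 1 /\ forall k,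
  e k.+1 *+ k.+1 = \sum_(j < k.+1) (-1) ^+ j * p j * e (k - j)%N.

Section Jensen.
Variable S : comNzRingType.
Implicit Types (f : {poly S}) (x c : S) (xs : seq S) (p e : nat -> S).

Lemma sos_tower_jensen_prod n c xs : sos_tower (jensen_prod n c xs).
Proof.
by elim: xs => [|x xs IHxs] /=; [apply: sos_tower_XsubC|apply: sos_tower_step].
Qed.

Lemma size_jensen_prod n c xs : (size (jensen_prod n c xs) <= n.+1)%N.
Proof.
elim: xs => [|x xs IHxs] /=; first by rewrite size_exp_XsubC.
rewrite (leq_trans (size_polyD _ _)) // geq_max IHxs (leq_trans (size_scale_leq _ _)) //.
have [->|nz] := eqVneq (jensen_prod n c xs) 0; first by rewrite deriv0 size_poly0.
by rewrite (leq_trans (ltnW (lt_size_deriv nz))).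
Qed.

Lemma jensen_prod_lead n c xs : (jensen_prod n c xs)`_n = 1.
Proof.
elim: xs => [|x xs IHxs] /=.
  have /monicP : ('X - c%:P) ^+ n \is monic by rewrite monic_exp ?monicXsubC.
  by rewrite lead_coefE size_exp_XsubC.
by rewrite coefD coefZ coef_deriv IHxs nth_default ?size_jensen_prod // mul0rn mulr0 addr0.
Qed.

(** Newton's identities in the form of a differential equation: for
    [f = sum_k e_k (X^n)^(k)] the left hand side is [sum_k k e_k (X^n)^(k)]. *)
Definition euler_eq n p f :=
  f *+ n - 'X * f^`() = \sum_(j < n.+1) ((-1) ^+ j * p j) *: f^`(j.+1).

(** Replacing [X] by [X - c] multiplies the generating series of the [e k] by
    [exp (- c z)], which changes the first power sum only. *)
Definition jensen_psum c xs (j : nat) : S :=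
  \sum_(x <- xs) x ^+ j.+1 - (if j is 0 then c else 0).

(** The operator [n - X d/dX] commutes with [1 + x d/dX] up to [x d/dX], and
    [x f'] is a telescoping alternating sum of derivatives of [f + x f']
    because [f] has degree at most [n]. *)
Lemma euler_eq_jensen_prod n c xs : euler_eq n (jensen_psum c xs) (jensen_prod n c xs).
Proof.
rewrite /euler_eq.
elim: xs => [|x xs IHxs] /=.
  have pE j : jensen_psum c [::] j = - (if j is 0 then c else 0).
    by rewrite /jensen_psum big_nil sub0r.
  rewrite big_ord_recl big1 => [|j _]; last by rewrite pE oppr0 mulr0 scale0r.
  rewrite pE /= expr0 mul1r addr0 deriv_exp derivXsubC mul1r scaleNr.
  case: n => [|n]; first by rewrite !mulr0n scaler0 mulr0 subr0 oppr0.
  rewrite /= exprS -mul_polyC; set u := _ ^+ n; rewrite -!mulrnAr.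
  by move: (u *+ _) => v; ring.
set f := jensen_prod n c xs in IHxs *; set g := f + _.
have fn2 : f^`(n.+2) = 0.
  apply/polyP => i; rewrite coef_derivn nth_default ?mul0rn ?coef0 //.
  by rewrite (leq_trans (size_jensen_prod _ _ _)) // ltnW // ltnS leq_addr.
have derg j : g^`(j) = f^`(j) + x *: f^`(j.+1).
  by rewrite derivnD derivnZ -derivSn.
pose u j := ((-1) ^+ j * x ^+ j.+1) *: f^`(j.+1).
have xder : x *: f^`() = \sum_(j < n.+1) ((-1) ^+ j * x ^+ j.+1) *: g^`(j.+1).
  rewrite -(big_mkord xpredT (fun j => ((-1) ^+ j * x ^+ j.+1) *: g^`(j.+1))).
  rewrite (@telescope_sumr_eq _ _ _ (fun j => - u j)) // => [|j _].
    by rewrite /u fn2 scaler0 oppr0 expr0 mul1r expr1 derivn1 add0r opprK.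
  rewrite derg /u scalerDr opprK addrC scalerA; congr (_ + _).
  by rewrite -scaleNr; congr (_ *: _); rewrite !exprS; ring.
have sumg : \sum_(j < n.+1) ((-1) ^+ j * jensen_psum c xs j) *: g^`(j.+1)
    = f *+ n - 'X * f^`() + x *: (f *+ n - 'X * f^`())^`().
  rewrite IHxs raddf_sum scaler_sumr -big_split /=; apply: eq_bigr => j _.
  by rewrite derivZ -!derivnS derg scalerDr !scalerA [x * _]mulrC.
under eq_bigr => j _.
  rewrite (_ : jensen_psum _ _ _ = jensen_psum c xs j + x ^+ j.+1); last first.
    by rewrite /jensen_psum big_cons; ring.
  rewrite mulrDr scalerDl; over.
rewrite big_split /= sumg -xder /g !poly.derivE -!mul_polyC.
by ring.
Qed.

Lemma coef_euler_eq n p f k : euler_eq n p f -> (size f <= n.+1)%N -> (k < n)%N ->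
  f`_(n - k.+1) *+ k.+1 =
  \sum_(j < k.+1) (-1) ^+ j * p j * (f`_(n - (k - j)) *+ (n - (k - j)) ^_ j.+1).
Proof.
move=> ef sf lt_kn; have := congr1 (fun g : {poly S} => g`_(n - k.+1)) ef.
rewrite coefB coefMn coefXM coef_deriv coef_sum.
have -> : f`_(n - k.+1) *+ n -
    (if (n - k.+1)%N == 0 then 0 else f`_(n - k.+1).-1.+1 *+ (n - k.+1).-1.+1)
    = f`_(n - k.+1) *+ k.+1.
  case: (n - k.+1)%N (subnK lt_kn) => [|m] /= <-; first by rewrite subr0.
  by rewrite addnC mulrnDr addrK.
move=> ->; rewrite -(big_mkord xpredT
   (fun j => (((-1) ^+ j * p j) *: f^`(j.+1))`_(n - k.+1))).
rewrite (big_cat_nat (n := k.+1)) //= 1?ltnW // big_mkord [X in _ + X]big_nat_cond.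
rewrite [X in _ + X]big1 ?addr0 => [|j /andP[/andP[kj _] _]]; last first.
  by rewrite coefZ -?derivnS coef_derivn nth_default ?mul0rn ?mulr0 // (leq_trans sf) //; lia.
apply: eq_bigr => j _; rewrite coefZ -?derivnS coef_derivn.
by have -> : (j.+1 + (n - k.+1) = n - (k - j))%N by have := ltn_ord j; lia.
Qed.

End Jensen.

(** The differential equation is a recursion for the coefficients, hence
    determines them from the leading one. *)
Lemma coef_newton (F : numFieldType) (S : comAlgType F) n (p e : nat -> S) (f : {poly S}) :
  newton e p -> euler_eq n p f -> (size f <= n.+1)%N -> f`_n = 1 ->
  forall k, (k <= n)%N -> f`_(n - k) = e k *+ n ^_ k.
Proof.
move=> [e0 eS] ef sf fn k; elim/ltn_ind: k => -[|k] IHk lt_kn.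
  by rewrite subn0 fn e0.
have natS_inj (u v : S) : u *+ k.+1 = v *+ k.+1 -> u = v.
  have k0 : k.+1%:R != 0 :> F by rewrite pnatr_eq0.
  move=> uv; rewrite -[u]scale1r -[v]scale1r -(mulVf k0) -2!scalerA.
  by rewrite (scaler_nat k.+1 u) (scaler_nat k.+1 v) uv.
apply: natS_inj; rewrite (coef_euler_eq ef) // -mulrnA mulnC mulrnA eS -sumrMnl.
apply: eq_bigr => j _; rewrite IHk; last 2 first.
- by rewrite ltnS leq_subr.
- by rewrite (leq_trans (leq_subr _ _)) // ltnW.
rewrite -mulrnA -mulrnAr; congr (_ * (_ *+ _)).
have ffactD a b : (n ^_ (a + b) = n ^_ a * (n - a) ^_ b)%N.
  elim: b => [|b IHb]; first by rewrite addn0 ffactn0 muln1.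
  by rewrite addnS !ffactnSr IHb subnDA mulnA.
by rewrite -ffactD; congr (n ^_ _)%N; have := ltn_ord j; lia.
Qed.

(** * Bezoutians *)

Definition wronskian (S : comNzRingType) (f : {poly S}) (i j : nat) : S :=
  j.+1%:R * (f`_i * f`_j.+1) - i.+1%:R * (f`_i.+1 * f`_j).

(** The relation [bezout_step] between [f(s) f(t)] and its successor, solved for
    the successor; this makes its entries polynomials in the coefficients of
    [f], compatible with ring morphisms. *)
Fixpoint bezout (S : comNzRingType) (f : {poly S}) (i j : nat) : S :=
  wronskian f i.+1 j + (if j is j'.+1 then bezout f i.+1 j' else 0).

Lemma bezout_step_unique (S : comNzRingType) (f : {poly S}) K :
  bezout_step (sq_kernel f) K -> forall i j, K i j = bezout f i j.
Proof.
move=> fK i j; elim: j i => [|j IHj] i /=.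
  by rewrite /wronskian addr0; have /= := fK i.+1 0; rewrite subr0.
by rewrite -IHj /wronskian; have /= := fK i.+1 j.+1; rewrite /sq_kernel => <-; rewrite subrK.
Qed.

Lemma map_bezout (S S' : comNzRingType) (h : {rmorphism S -> S'}) (f : {poly S}) i j :
  bezout (map_poly h f) i j = h (bezout f i j).
Proof.
elim: j i => [|j IHj] i /=; rewrite ?IHj rmorphD ?rmorph0 /wronskian rmorphB /= !rmorphM /= !rmorph_nat;
  by rewrite !coef_map.
Qed.

Lemma wronskian_anti (S : comNzRingType) (f : {poly S}) i j : wronskian f j i = - wronskian f i j.
Proof. by rewrite /wronskian; ring. Qed.

Lemma bezoutE (S : comNzRingType) (f : {poly S}) i j :
  bezout f i j = \sum_(l < j.+1) wronskian f (i + l).+1 (j - l).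
Proof.
elim: j i => [|j IHj] i /=; first by rewrite big_ord1 addr0 addn0.
rewrite IHj [RHS]big_ord_recl /= addn0; congr (_ + _); apply: eq_bigr => l _.
by rewrite /bump addnS addSn subSS.
Qed.

(** The recursion uses the equations of positive first index.  The remaining
    ones say that the Wronskian vanishes on the diagonal [s = t], which holds
    by antisymmetry. *)
Lemma bezout_stepP (F : numDomainType) (f : {poly F}) : bezout_step (sq_kernel f) (bezout f).
Proof.
move=> [|i] [|j]; rewrite /sq_kernel /=.
- by rewrite subr0; ring.
- rewrite sub0r; apply/eqP; rewrite eq_sym -subr_eq0 opprK addrC.
  set w := (X in _ + X); have -> : w = wronskian f 0 j.+1 by [].
  rewrite {w} bezoutE addrC.
  have -> : wronskian f 0 j.+1 + \sum_(l < j.+1) wronskian f (0 + l).+1 (j - l)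
     = \sum_(l < j.+2) wronskian f l (j.+1 - l).
    by rewrite [RHS]big_ord_recl subn0; congr (_ + _); apply: eq_bigr => l _; rewrite lift0 subSS.
  set s := \sum_(l < _) _; suff : s = - s by move/eqP; rewrite -addr_eq0 -mulr2n mulrn_eq0.
  rewrite {1}/s (reindex_inj rev_ord_inj) -sumrN /=; apply: eq_bigr => l _.
  by rewrite wronskian_anti subSS; congr (- wronskian f _ _); have := ltn_ord l; lia.
- by rewrite subr0 addr0.
- by rewrite /wronskian; ring.
Qed.

Lemma bezout_small (F : numDomainType) (f : {poly F}) n i j : (size f <= n.+1)%N ->
  (n <= i)%N || (n <= j)%N -> bezout f i j = 0.
Proof.
move=> sf.
have f0 k : (n < k)%N -> f`_k = 0 by move=> nk; rewrite nth_default // (leq_trans sf).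
case/orP => [le_ni|].
  rewrite bezoutE big1 // => l _; rewrite /wronskian.
  have -> : f`_(i + l).+1 = 0 by apply: f0; lia.
  have -> : f`_(i + l).+2 = 0 by apply: f0; lia.
  by rewrite !mul0r !mulr0 subr0.
elim: i j => [|i IHi] j le_nj.
all: have fj1 : f`_j.+1 = 0 by apply: f0.
all: have fj2 : f`_j.+2 = 0 by apply: f0; apply: leqW.
  have /eqP := bezout_stepP f 0 j.+1; rewrite /sq_kernel fj1 fj2 !mulr0 subr0.
  by rewrite subr_eq0 => /eqP.
have /eqP := bezout_stepP f i.+1 j.+1; rewrite /sq_kernel fj1 fj2 !mulr0 subr0.
by rewrite subr_eq0 => /eqP /esym e; rewrite -(IHi j.+1) ?leqW.
Qed.

Lemma horner2_bezout_step (S : comNzRingType) n (K L : nat -> nat -> S) s t :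
  bezout_step K L ->
  (forall i j, (n <= i)%N || (n <= j)%N -> L i j = 0) ->
  (s - t) * \sum_(i < n) \sum_(j < n) L i j * (s ^+ i * t ^+ j) =
  \sum_(i < n.+1) \sum_(j < n.+1)
     (j.+1%:R * K i j.+1 - i.+1%:R * K i.+1 j) * (s ^+ i * t ^+ j).
Proof.
move=> KL L0; under [RHS]eq_bigr => i _ do
  under eq_bigr => j _ do rewrite -(KL i j) mulrBl.
under [RHS]eq_bigr => i _ do rewrite sumrB.
rewrite sumrB mulrBl; congr (_ - _).
  rewrite big_ord_recl [X in _ = X + _]big1 ?add0r => [|j _]; last by rewrite mul0r.
  rewrite mulr_sumr; apply: eq_bigr => i _.
  rewrite big_ord_recr /= L0 ?leqnn ?orbT // mul0r addr0 mulr_sumr.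
  by apply: eq_bigr => j _; rewrite exprS; ring.
rewrite big_ord_recr /= [X in _ = _ + X]big1 ?addr0 => [|j _]; last first.
  by case: (j : nat) => [|k] /=; rewrite ?L0 ?leqnn ?mul0r.
rewrite mulr_sumr; apply: eq_bigr => i _.
rewrite big_ord_recl /= mul0r add0r mulr_sumr.
by apply: eq_bigr => j _; rewrite exprS; ring.
Qed.

(** The defining identity [(s - t) B(s, t) = f(s) f'(t) - f'(s) f(t)]. *)
Lemma horner_bezout (F : numDomainType) (f : {poly F}) n s t : (size f <= n.+1)%N ->
  (s - t) * \sum_(i < n) \sum_(j < n) bezout f i j * (s ^+ i * t ^+ j) =
  f.[s] * f^`().[t] - f^`().[s] * f.[t].
Proof.
move=> sf; rewrite (horner2_bezout_step (K := sq_kernel f)) //; [|exact: bezout_stepP|by move=> i j; apply: bezout_small].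
have sf' : (size f^`() <= n.+1)%N.
  have [->|nz] := eqVneq f 0; first by rewrite deriv0 size_poly0.
  by rewrite (leq_trans (ltnW (lt_size_deriv nz))).
rewrite !(horner_coef_wide _ sf) !(horner_coef_wide _ sf') !big_distrlr -sumrB /=.
apply: eq_bigr => i _; rewrite -sumrB; apply: eq_bigr => j _.
rewrite /sq_kernel !coef_deriv; ring.
Qed.

(** * Hermite's theorem: a positive semidefinite Bezoutian forces real roots *)

Section PsdBezout.
Variables (C : numClosedFieldType) (n : nat) (f : {poly C}).
Hypotheses (sz_f : (size f <= n.+1)%N) (f_real : map_poly Num.conj f = f).
Hypothesis bezout_psd : forall v : nat -> C, (forall i, v i \is Num.real) ->
  0 <= \sum_(i < n) \sum_(j < n) v i * v j * bezout f i j.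

(** At [s = z] and [t = z^*] the Bezoutian is the sum of the values of its
    quadratic form at the real and at the imaginary parts of the powers of [z].
    The conclusion says that the imaginary parts of [f'(z) / f(z)] and of [z]
    never have the same strict sign. *)
Lemma Im_logder_ge0 z : 0 <= 'Im (f.[z] * (f^`().[z])^*) * 'Im z.
Proof.
have bezout_re i j : bezout f i j \is Num.real.
  by rewrite CrealE -map_bezout f_real.
have conj_f w : f.[w^*] = (f.[w])^* by rewrite -horner_map /= f_real.
have conj_f' w : f^`().[w^*] = (f^`().[w])^*.
  by rewrite -horner_map /= -deriv_map f_real.
pose B := \sum_(i < n) \sum_(j < n) bezout f i j * (z ^+ i * z^* ^+ j).
have reB : 0 <= 'Re B.
  have -> : 'Re B = \sum_(i < n) \sum_(j < n) 'Re (z ^+ i) * 'Re (z ^+ j) * bezout f i j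
     + \sum_(i < n) \sum_(j < n) 'Im (z ^+ i) * 'Im (z ^+ j) * bezout f i j.
    rewrite -big_split raddf_sum; apply: eq_bigr => i _ /=.
    rewrite -big_split raddf_sum; apply: eq_bigr => j _ /=.
    by rewrite ReMl ?bezout_re // -rmorphXn /= ReM Re_conj Im_conj; ring.
  apply: addr_ge0.
    by apply: (bezout_psd (v := fun i => 'Re (z ^+ i))) => i; apply: Creal_Re.
  by apply: (bezout_psd (v := fun i => 'Im (z ^+ i))) => i; apply: Creal_Im.
have := horner_bezout z z^* sz_f; rewrite -/B conj_f conj_f'.
set w := f.[z] * _ => /(congr1 (@Im C)).
have -> : f^`().[z] * (f.[z])^* = w^* by rewrite /w rmorphM /= conjCK mulrC.
have subJ u : u - u^* = 2 * 'i * 'Im u.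
  by rewrite ImE; transitivity ('i ^+ 2 * (u^* - u)); [rewrite sqrCi; ring|field].
have Im2 (r u : C) : r \is Num.real -> 'Im (2 * 'i * r * u) = 2 * r * 'Re u.
  move=> r_re; rewrite (_ : 2 * 'i * r * u = (2 * r) * ('i * u)); last by ring.
  by rewrite ImMl ?ImMil // rpredM ?realn.
rewrite !subJ -[2 * 'i * 'Im w]mulr1 !Im2 ?Creal_Im // => e.
have re1 : 'Re (1 : C) = 1 by apply/Creal_ReP; rewrite realE ler01.
have -> : 'Im w = 'Im z * 'Re B.
  apply: (@mulfI _ 2); first by rewrite pnatr_eq0.
  by rewrite mulrA e re1 mulr1.
by rewrite mulrAC mulr_ge0 // -expr2 real_exprn_even_ge0 ?Creal_Im.
Qed.

(** Near a root [z] of multiplicity [k + 1] the quotient [f' / f] behaves like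
    [(k + 1) / (s - z)].  At a point [s] reached from a nonreal [z] by moving
    slightly towards the real axis, this has a large imaginary part of the sign
    forbidden by [Im_logder_ge0]. *)
Lemma psd_bezout_real_root z : f != 0 -> root f z -> z \is Num.real.
Proof.
move=> f0 rfz; apply/Creal_ImP/eqP; apply: contraT => b0.
have [m [g]] := multiplicity_XsubC f z; rewrite f0 /= => gz.
case: m => [|k] fE.
  by move: rfz gz; rewrite fE mulr1 => ->.
have [M ltM] := poly_disk_bound g^`() (`|z| + `|'Im z|).
have [q /eqP gE] : {q : {poly C} | g == (g.[z])%:P + q * ('X - z%:P)}.
  by exists (g %/ ('X - z%:P)); rewrite {1}(divp_eq g ('X - z%:P)) modp_XsubC addrC.
have [N ltN] := poly_disk_bound q (`|z| + `|'Im z|).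
pose b := 'Im z; have b_re : b \is Num.real := Creal_Im z.
(* Here [f = g (X - z)^(k + 1)] with [g] nonzero at [z]; as [e] is arbitrary,
   this estimate forces [g] to vanish at [z]. *)
have bound (e : C) : 0 < e -> e < 1 -> `|g.[z]| <= e * (`|b| * (M + N)).
  move=> e0 e1; have e_re : e \is Num.real by rewrite realE ltW.
  pose d := - ('i * (e * b)); pose s := z + d.
  have nd : `|d| = e * `|b|.
    by rewrite normrN normrM normCi mul1r normrM (gtr0_norm e0).
  have s_le : `|s| <= `|z| + `|b|.
    rewrite (le_trans (ler_normD _ _)) // lerD2l nd ger_pMl ?normr_gt0 //.
    exact: ltW.
  have gs_le : `|g.[s]| <= e * `|b| * M.
    have M0 : 0 <= M by rewrite (le_trans _ (ltM z _)) // lerDl.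
    have [->|gs0] := eqVneq g.[s] 0; first by rewrite normr0 !mulr_ge0 // ltW.
    have Im_s : 'Im s = b * (1 - e).
      rewrite /s /d raddfD raddfN /= ImMil.
      by rewrite (Creal_ReP _ _) ?rpredM // -/b; ring.
    have dd : d * d^* = (e * `|b|) ^+ 2 by rewrite -normCK nd.
    set u := g.[s] * (g^`().[s])^*.
    have := Im_logder_ge0 s; rewrite Im_s.
    have -> : f.[s] * (f^`().[s])^*
        = (`|d| ^+ 2) ^+ k * ((e * `|b|) ^+ 2 * u - 'i * ((e * b) * (`|g.[s]| ^+ 2 *+ k.+1))).
      rewrite fE derivM deriv_exp derivXsubC mul1r !hornerE /= hornerMn !hornerE.
      rewrite (_ : s - z = d); last by rewrite /s; ring.
      rewrite !normCK rmorphD !rmorphM rmorphMn /= !rmorphXn /= -dd /u.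
      have -> : 'i * e * b = - d by rewrite /d; ring.
      by rewrite exprMn !exprS; move: (d^*) => dc; ring.
    rewrite ImMl; last by apply: rpredX; apply: rpredX; apply: normr_real.
    rewrite raddfB /= ImMil (Creal_ReP _ _); last first.
      by apply: rpredM; [apply: rpredM|apply: rpredMn; apply: rpredX; apply: normr_real].
    rewrite ImMl; last by apply: rpredX; apply: rpredM; rewrite ?normr_real.
    have b_sq : `|b| ^+ 2 = b ^+ 2 by rewrite real_normK.
    have -> : (`|d| ^+ 2) ^+ k * ((e * `|b|) ^+ 2 * 'Im u - e * b * (`|g.[s]| ^+ 2 *+ k.+1)) * (b * (1 - e))
       = ((`|d| ^+ 2) ^+ k * (1 - e) * e * b ^+ 2) * (e * b * 'Im u - `|g.[s]| ^+ 2 *+ k.+1).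
      by rewrite [(e * _) ^+ 2]exprMn b_sq; ring.
    rewrite pmulr_rge0; last first.
      apply: mulr_gt0; last by rewrite real_exprn_even_gt0.
      apply: mulr_gt0 => //; apply: mulr_gt0; last by rewrite subr_gt0.
      by rewrite !exprn_gt0 // nd mulr_gt0 // normr_gt0.
    rewrite subr_ge0 => le1.
    have : `|g.[s]| ^+ 2 <= e * `|b| * M * `|g.[s]|.
      rewrite (@le_trans _ _ (`|g.[s]| ^+ 2 *+ k.+1)) //.
        by rewrite mulrS lerDl mulrn_wge0 // exprn_ge0.
      apply: (le_trans le1); rewrite (le_trans (real_ler_norm _)) //.
        by apply: rpredM; [apply: rpredM|apply: Creal_Im].
      rewrite !normrM (gtr0_norm e0) -!mulrA.
      apply: ler_wpM2l; [exact: ltW|apply: ler_wpM2l => //].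
      rewrite (@le_trans _ _ `|u|) //.
        by rewrite -normrN -ReMil (le_trans (leif_normC_Re_Creal _)) // normrM normCi mul1r.
      by rewrite /u normrM norm_conjC mulrC ler_wpM2r // ltM.
    by rewrite expr2 ler_pM2r // normr_gt0.
  have -> : g.[z] = g.[s] - q.[s] * d.
    by rewrite [in g.[s]]gE !hornerE /s; ring.
  rewrite (le_trans (ler_normB _ _)) // normrM nd.
  rewrite (_ : e * (`|b| * (M + N)) = e * `|b| * M + N * (e * `|b|)); last by ring.
  by rewrite lerD // ler_wpM2r ?ltN // mulr_ge0 // ltW.
have K0 : 0 <= `|b| * (M + N).
  rewrite mulr_ge0 // addr_ge0 //; first by rewrite (le_trans _ (ltM z _)) // lerDl.
  by rewrite (le_trans _ (ltN z _)) // lerDl.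
set K := `|b| * _ in K0 bound; set G := `|g.[z]| in bound.
have G0 : 0 < G by rewrite normr_gt0.
have D0 : 0 < G + K + 1 by rewrite ltr_wpDl // addr_ge0 // ltW.
(* For this value of [e] the bound [G <= e K] fails. *)
have := bound (G / (G + K + 1)); rewrite divr_gt0 // ltr_pdivrMr // mul1r.
have GK : G < G + (K + 1) by rewrite ltrDl ltr_wpDl.
rewrite -addrA GK => /(_ isT isT); rewrite mulrAC ler_pdivlMr ?addrA //.
by rewrite ler_pM2l // -addrA addrCA gerDl lt_geF // addr_gt0.
Qed.
End PsdBezout.

Lemma psd_bezout_split (R : rcfType) n (f : {poly R}) : f \is monic -> size f = n.+1 ->
  (forall v : nat -> R, 0 <= \sum_(i < n) \sum_(j < n) v i * v j * bezout f i j) ->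
  exists2 s : seq R, size s = n & f = \prod_(y <- s) ('X - y%:P).
Proof.
move=> fmon szf psd.
pose toC : {rmorphism R -> R[i]} := real_complex R.
set F := map_poly toC f.
have szF : size F = n.+1 by rewrite size_map_poly.
have F_real : map_poly Num.conj F = F.
  apply/polyP => i; rewrite !coef_map /=.
  by apply/CrealP/complex_realP; exists f`_i.
have psdF (v : nat -> R[i]) : (forall i, v i \is Num.real) ->
    0 <= \sum_(i < n) \sum_(j < n) v i * v j * bezout F i j.
  move=> v_re; pose w i := complex.Re (v i).
  have -> : \sum_(i < n) \sum_(j < n) v i * v j * bezout F i j
     = toC (\sum_(i < n) \sum_(j < n) w i * w j * bezout f i j).
    rewrite rmorph_sum; apply: eq_bigr => i _; rewrite rmorph_sum; apply: eq_bigr => j _.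
    by rewrite !rmorphM /= map_bezout /w !RRe_real.
  by rewrite /= ler0c psd.
have [r] := closed_field_poly_normal F.
rewrite lead_coef_map (monicP fmon) rmorph1 scale1r => FE.
have r_real z : z \in r -> z \is Num.real.
  move=> zr; apply: (psd_bezout_real_root (n := n) _ F_real psdF); rewrite ?szF //.
    by rewrite -size_poly_eq0 szF.
  by rewrite FE root_prod_XsubC.
exists [seq complex.Re z | z <- r].
  by have := szF; rewrite FE size_prod_XsubC size_map => -[].
apply: (map_poly_inj toC); rewrite -/F FE rmorph_prod big_map.
rewrite big_seq_cond [RHS]big_seq_cond; apply: eq_bigr => z /andP[zr _].
by rewrite rmorphB /= map_polyX map_polyC /= RRe_real ?r_real.
Qed.

(** * Newton's identities *)

Lemma newton_ex (F : numFieldType) (S : comAlgType F) (p : nat -> S) : exists e, newton e p.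
Proof.
pose next k (l : seq S) := (k.+1%:R^-1 : F) *: (\sum_(j < k.+1) (-1) ^+ j * p j * l`_j).
(* The list [rows k] is [e k, ..., e 0]. *)
pose rows := fix rows k := if k is k'.+1 then next k' (rows k') :: rows k' else [:: 1].
have rowsE k j : (j <= k)%N -> (rows k)`_j = (rows (k - j)%N)`_0.
  by elim: k j => [|k IHk] [|j] //= /IHk ->; rewrite subSS.
exists (fun k => (rows k)`_0); split=> [|k] //=.
rewrite /next -scaler_nat scalerA mulfV ?pnatr_eq0 // scale1r.
by apply: eq_bigr => j _; rewrite rowsE // -ltnS ltn_ord.
Qed.

(** Its coefficients are the elementary symmetric functions of [xs]. *)
Definition esym_gf (S : comNzRingType) (xs : seq S) : {poly S} :=
  \prod_(x <- xs) (1 + x *: 'X).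

Lemma coef_esym_gf_cons (S : comNzRingType) (x : S) xs k :
  (esym_gf (x :: xs))`_k = (esym_gf xs)`_k + (if k is k'.+1 then x * (esym_gf xs)`_k' else 0).
Proof.
rewrite /esym_gf big_cons mulrDl mul1r coefD -scalerAl coefZ coefXM.
by case: k => [|k] //=; rewrite mulr0.
Qed.

(** Adding a variable [x] adds [x e_(k-1)] to [e_k] and [x^(j+1)] to the power
    sums; the contributions of the latter telescope. *)
Lemma newton_esym_gf (S : comNzRingType) (xs : seq S) :
  newton (fun k => (esym_gf xs)`_k) (fun j => \sum_(x <- xs) x ^+ j.+1).
Proof.
elim: xs => [|x xs [q0 IHq]].
  rewrite /esym_gf big_nil; split=> [|k]; first by rewrite coef1.
  by rewrite coef1 mul0rn big1 // => j _; rewrite big_nil mulr0 mul0r.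
split; first by rewrite coef_esym_gf_cons q0 addr0.
set q := esym_gf xs in q0 IHq *; set q' := esym_gf _.
have q'S k : q'`_k.+1 = q`_k.+1 + x * q`_k by rewrite /q' coef_esym_gf_cons.
have q'0 : q'`_0 = 1 by rewrite /q' coef_esym_gf_cons q0 addr0.
have tele k : \sum_(j < k.+1) (-1) ^+ j * x ^+ j.+1 * q'`_(k - j) = x * q`_k.
  elim: k => [|k IHk]; first by rewrite big_ord1 q'0 q0; ring.
  rewrite big_ord_recl subn0 q'S.
  under eq_bigr => j _ do rewrite lift0 subSS.
  rewrite (_ : \sum_(j < _) _ = - x * (x * q`_k)); first by ring.
  by rewrite -IHk mulr_sumr; apply: eq_bigr => j _; rewrite !exprS; ring.
pose P j := \sum_(y <- xs) y ^+ j.+1.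
have rest k : \sum_(j < k.+1) (-1) ^+ j * P j * q'`_(k - j)
    = \sum_(j < k.+1) (-1) ^+ j * P j * q`_(k - j) + x * (q`_k *+ k).
  case: k => [|k]; first by rewrite !big_ord1 q'0 q0 mulr0n; ring.
  have -> : q`_k.+1 *+ k.+1 = \sum_(j < k.+1) (-1) ^+ j * P j * q`_(k - j) := IHq k.
  have -> : \sum_(j < k.+2) (-1) ^+ j * P j * q'`_(k.+1 - j) =
     \sum_(j < k.+1) (-1) ^+ j * P j * (q`_(k.+1 - j) + x * q`_(k - j)) + (-1) ^+ k.+1 * P k.+1.
    rewrite big_ord_recr /= subnn q'0 mulr1; congr (_ + _); apply: eq_bigr => j _.
    by rewrite subSn ?q'S // -ltnS.
  rewrite [X in _ = X + _]big_ord_recr /= subnn q0 mulr1 -/(P _) addrAC [x * _]mulr_sumr -big_split /=.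
  by congr (_ + _); apply: eq_bigr => j _; ring.
move=> k; under eq_bigr => j _ do rewrite big_cons mulrDr mulrDl.
by rewrite big_split /= tele rest -IHq q'S; ring.
Qed.

Lemma size_esym_gf (S : comNzRingType) (xs : seq S) : (size (esym_gf xs) <= (size xs).+1)%N.
Proof.
elim: xs => [|x xs IHxs]; first by rewrite /esym_gf big_nil size_poly1.
apply/leq_sizeP => k /=; rewrite coef_esym_gf_cons.
move: IHxs => /leq_sizeP IHxs; case: k => // k lt_k.
by rewrite !IHxs ?mulr0 ?addr0 // ltnW.
Qed.

Lemma coef_prod_XsubC_esym (S : comNzRingType) (s : seq S) c k : (k <= size s)%N ->
  (\prod_(y <- s) ('X - y%:P))`_(size s - k) * c ^+ k = (esym_gf [seq - c * y | y <- s])`_k.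
Proof.
elim: s k => [|y s IHs] k /=.
  by case: k => // _; rewrite /esym_gf !big_nil !coef1 expr0 mulr1.
rewrite coef_esym_gf_cons big_cons mulrBl coefB coefXM mul_polyC coefZ.
set f := \prod_(z <- s) _; have szf : size f = (size s).+1 by rewrite size_prod_XsubC.
case: k => [|k] le_k.
  rewrite subn0 /= [f`_(size s).+1]nth_default ?szf // mulr0 subr0 addr0.
  by rewrite -IHs // subn0.
rewrite subSS -(IHs k le_k).
have [lt_k|] := ltnP k (size s).
  rewrite -(IHs k.+1 lt_k) -[(size s - k)%N](subnSK lt_k) /= !exprS.
  by move: (c ^+ k) => z; ring.
rewrite leq_eqVlt ltnNge -ltnS le_k orbF => /eqP <-; rewrite subnn /=.
rewrite [(esym_gf _)`_(size s).+1]nth_default.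
  by rewrite exprS; move: (c ^+ size s) => z; ring.
by rewrite (leq_trans (size_esym_gf _)) // size_map.
Qed.

(** * Evaluation in the polynomial ring in countably many indeterminates *)

(** Squares are sent to squares, so the morphism is monotone; being the identity
    on the rationals, it is the identity. *)
Lemma rmorph_realE (R : realType) (g : {rmorphism R -> R}) c : g c = c.
Proof.
have g_homo x y : x <= y -> g x <= g y.
  rewrite -subr_ge0 => xy; rewrite -subr_ge0 -rmorphB.
  by rewrite -(sqr_sqrtr xy) rmorphXn sqr_ge0.
have [lt_gc|lt_cg|//] := ltgtP (g c) c.
  have [q] := rat_in_itvoo lt_gc; rewrite in_itv /= => /andP[gq qc].
  by have := g_homo _ _ (ltW qc); rewrite fmorph_rat leNgt gq.
have [q] := rat_in_itvoo lt_cg; rewrite in_itv /= => /andP[gq qc].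
by have := g_homo _ _ (ltW gq); rewrite fmorph_rat leNgt qc.
Qed.

Section Ceval.
Variables (R : realType).

Definition cmonom_eval (S : comNzRingType) (v : nat -> S) (m : cmonom nat) : S :=
  \prod_(i <- finsupp m) v i ^+ m i.

Lemma cmonom_evalE (S : comNzRingType) (v : nat -> S) (m : cmonom nat) (d : {fset nat}) :
  (finsupp m `<=` d)%fset -> cmonom_eval v m = \prod_(i <- d) v i ^+ m i.
Proof.
move=> md; rewrite /cmonom_eval (big_fset_incl _ md) //= => i _.
by rewrite -cmE_neq0 negbK => /eqP ->.
Qed.

Lemma cmonom_eval_mmorphism (S : comNzRingType) (v : nat -> S) : mmorphism (cmonom_eval v).
Proof.
split=> [m1 m2|]; last by rewrite /cmonom_eval mdom1 big_seq_fset0.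
rewrite {1}/cmonom_eval mdomD.
rewrite (cmonom_evalE v (fsubsetUl _ (finsupp m2))) (cmonom_evalE v (fsubsetUr (finsupp m1) _)).
by rewrite -big_split /=; apply: eq_bigr => i _; rewrite cmM exprD.
Qed.

HB.instance Definition _ (S : comNzRingType) (v : nat -> S) :=
  monalg.isMultiplicative.Build (cmonom nat) S (cmonom_eval v) (cmonom_eval_mmorphism v).

Lemma cmonom_eval_ucm (S : comNzRingType) (v : nat -> S) i : cmonom_eval v (ucm i) = v i.
Proof. by rewrite /cmonom_eval mdomU big_seq_fset1 cmUU expr1. Qed.

(** By induction on the degree: the monomials are generated by the [ucm i]. *)
Lemma mmorphism_eq (S : comNzRingType) (g h : cmonom nat -> S) :
  mmorphism g -> mmorphism h -> (forall i, g (ucm i) = h (ucm i)) -> g =1 h.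
Proof.
move=> [gM g1] [hM h1] gh m; have [k] := ubnP (monalg.mdeg m).
elim: k m => // k IHk m; rewrite ltnS => le_k.
have [->|/eqP m1] := eqVneq m (monalg.one : cmonom nat); first by rewrite g1 h1.
have [i im] : exists i, i \in finsupp m.
  suff /fset0Pn[i im] : finsupp m != fset0 by exists i.
  apply: contra_notN m1 => /eqP m0; apply/eqP/cmP => i.
  by rewrite cm1; apply/eqP; rewrite cmE_eq0 m0.
have mE : m = monalg.mul (ucm i) (divcm m (ucm i)).
  apply/eqP/cmP => j; rewrite cmM divcmE cmU subnKC //.
  by case: eqVneq => // <-; rewrite lt0n cmE_neq0.
move: le_k; rewrite mE mdegM mdegU add1n => le_k.
by rewrite gM hM gh IHk.
Qed.

Lemma ceval_rmorphism (S : comAlgType R) (v : nat -> S) :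
  exists h : {rmorphism cpoly R -> S}, [/\ h =1 ceval v,
    forall c : R, h (c *: 1) = c *: 1 & forall i, h (cvar R i) = v i].
Proof.
exists (monalg.mmap (in_alg S) (cmonom_eval v)); split=> // [c|i].
  have := @monalg.mmapZ (cmonom nat) R S (in_alg S) (cmonom_eval v) c 1.
  by rewrite monalg.mmap1 mulr1.
by rewrite /cvar /= mmapU /= scale1r mul1r cmonom_eval_ucm.
Qed.

(** A ring morphism that respects the scalars is evaluation at the images of the
    indeterminates. *)
Lemma rmorph_ceval (S : comAlgType R) (h : {rmorphism cpoly R -> S}) :
  (forall c : R, h (c *: 1) = c *: 1) -> forall f, h f = ceval (fun i => h (cvar R i)) f.
Proof.
move=> hc f.
pose U (m : cmonom nat) : cpoly R := mkmalgU m 1.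
have UM : mmorphism (h \o U).
  split=> [m1 m2|] /=; last by rewrite -[RHS](rmorph1 h).
  by rewrite -rmorphM; congr (h _); rewrite malgM_def fgmulUU mulr1.
have hU m : h (U m) = cmonom_eval (fun i => h (cvar R i)) m.
  apply: (mmorphism_eq UM (cmonom_eval_mmorphism _)) => i.
  by rewrite cmonom_eval_ucm.
rewrite {1}[f]monalgE rmorph_sum /ceval /monalg.mmap; apply: eq_bigr => m _.
have -> : mkmalgU m (monalg.mcoeff m f) = (monalg.mcoeff m f *: 1) * U m.
  by rewrite mulr_algl -mul_malgC malgM_def fgmulUU mulr1 mul1m.
rewrite (rmorphM h) hc; congr (_ * _); exact: (hU m).
Qed.

Lemma rmorph_comp_ceval (S S' : comAlgType R) (h : {rmorphism S -> S'}) (v : nat -> S) :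
  (forall c : R, h (c *: 1) = c *: 1) -> forall f, h (ceval v f) = ceval (h \o v) f.
Proof.
move=> hc f; have [g [gE gc gv]] := ceval_rmorphism v.
rewrite -gE; have := @rmorph_ceval _ (h \o g) _ f => /= ->; last by move=> c; rewrite gc hc.
by congr (ceval _ f); apply/funext => i /=; rewrite gv.
Qed.
End Ceval.

(** * Positivity of the Bezoutians of the Jensen polynomials *)

Section Truncation.
Variables (R : realType) (n : nat).

Definition pvars : seq (mpoly n R) := [seq mpolyX R (mnm1 i) | i : 'I_n].

Lemma sum_pvars k : \sum_(x <- pvars) x ^+ k = psum R n k.
Proof. by rewrite /pvars big_image. Qed.

Lemma trunc_inclA f : trunc n (inclA f) = ceval (fun i => psum R n i.+2) f.
Proof.
have [g [gE gc gv]] := ceval_rmorphism (fun i => psum R n i.+1).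
rewrite /trunc -gE /inclA rmorph_comp_ceval //.
by congr (ceval _ f); apply/funext => i /=; rewrite gv.
Qed.
End Truncation.

Definition jensen_poly (S : nzRingType) (e : nat -> S) (N : nat) : {poly S} :=
  \poly_(i < N.+1) (e (N - i)%N *+ N ^_ (N - i)).

Lemma map_jensen_poly (S S' : nzRingType) (h : {rmorphism S -> S'}) (e : nat -> S) N :
  map_poly h (jensen_poly e N) = jensen_poly (h \o e) N.
Proof.
apply/polyP => i; rewrite coef_map !coef_poly; case: ifP => _ /=; last by rewrite rmorph0.
by rewrite rmorphMn.
Qed.

Lemma map_newton (S S' : nzRingType) (h : {rmorphism S -> S'}) (e p : nat -> S) :
  newton e p -> newton (h \o e) (h \o p).
Proof.
move=> [e0 eS]; split=> [|k] /=; first by rewrite e0 rmorph1.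
rewrite -rmorphMn eS rmorph_sum; apply: eq_bigr => j _ /=.
by rewrite !rmorphM rmorphXn rmorphN1.
Qed.

Lemma jensen_poly_monic (S : nzRingType) (e : nat -> S) N : e 0 = 1 ->
  jensen_poly e N \is monic /\ size (jensen_poly e N) = N.+1.
Proof.
move=> e0; have c1 : e (N - N)%N *+ N ^_ (N - N) = 1 by rewrite subnn e0.
split; last by rewrite size_poly_eq // c1 oner_neq0.
by rewrite monicE lead_coef_poly // c1 ?oner_neq0.
Qed.

(** The coefficients of [jensen_prod] involve the points only through their
    power sums. *)
Lemma jensen_poly_prod (F : numFieldType) (S : comAlgType F) (e p : nat -> S) N c xs :
  newton e p -> jensen_psum c xs =1 p -> jensen_poly e N = jensen_prod N c xs.
Proof.
move=> nep xsp; apply/polyP => i; rewrite coef_poly.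
case: ltnP => [le_i|lt_i]; last by rewrite nth_default // (leq_trans (size_jensen_prod _ _ _)).
have ej : euler_eq N p (jensen_prod N c xs).
  by rewrite /euler_eq euler_eq_jensen_prod; apply: eq_bigr => j _; rewrite xsp.
rewrite -(coef_newton nep ej) ?size_jensen_prod ?jensen_prod_lead ?leq_subr //.
by rewrite subKn.
Qed.

Section Positivity.
Variables (R : realType).

(** Turns the sequence [p_2, p_3, ...] into [p_1, p_2, p_3, ...] with
    [p_1 = 0]. *)
Definition pshift (S : nzRingType) (a : nat -> S) (j : nat) : S :=
  if j is j'.+1 then a j' else 0.

Definition bezout_form (S : comAlgType R) (f : {poly S}) N (v : nat -> R) : S :=
  \sum_(i < N) \sum_(j < N) (v i * v j) *: bezout f i j.

Lemma sos_bezout_form (S : comAlgType R) N c (xs : seq S) v :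
  is_sos (bezout_form (jensen_prod N c xs) N v).
Proof.
have [K [K0 Ksos Kt]] := sos_tower_jensen_prod N c xs.
have [s K1] := Ksos 1.
have t01 : bezout_step (sq_kernel (jensen_prod N c xs)) (K 1).
  by move=> i j; rewrite (Kt 0); congr (_ * _ - _ * _); exact: K0.
have bezoutE i j : bezout (jensen_prod N c xs) i j = \sum_(b <- s) b`_i * b`_j.
  by rewrite -(bezout_step_unique t01) K1.
exists [seq \sum_(i < N) v i *: (b : {poly S})`_i | b <- s].
rewrite big_map /bezout_form.
rewrite (eq_bigr (fun i : 'I_N => \sum_(b <- s) \sum_(j < N) (v i *: (b : {poly S})`_i) * (v j *: b`_j))).
  rewrite exchange_big /=; apply: eq_bigr => b _.
  by rewrite expr2 big_distrlr.
move=> i _; rewrite exchange_big; apply: eq_bigr => j _ /=.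
rewrite bezoutE scaler_sumr; apply: eq_bigr => b _.
by rewrite -scalerAl -scalerAr scalerA.
Qed.

Variable e : nat -> symA R.
Hypothesis newton_e : newton e (pshift (pA R)).

(** In [n] variables the translation by their sum cancels the first power sum,
    so that the Jensen polynomial built from [p_2, p_3, ...] is a
    [jensen_prod], for which the certificate is available. *)
Lemma Sigma_bezout_form N v : Sigma R (inclA (bezout_form (jensen_poly e N) N v)).
Proof.
move=> n n0; rewrite trunc_inclA.
have [h [hE hc hv]] := ceval_rmorphism (fun i => psum R n i.+2).
rewrite -hE.
have -> : h (bezout_form (jensen_poly e N) N v) = bezout_form (jensen_poly (h \o e) N) N v.
  rewrite -map_jensen_poly /bezout_form rmorph_sum; apply: eq_bigr => i _.
  rewrite rmorph_sum; apply: eq_bigr => j _ /=.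
  by rewrite -[_ *: bezout (jensen_poly e N) i j]mulr_algl rmorphM /= hc map_bezout mulr_algl.
rewrite (@jensen_poly_prod _ _ _ _ N (psum R n 1) (pvars R n) (map_newton h newton_e)).
  exact: sos_bezout_form.
move=> [|j]; rewrite /jensen_psum sum_pvars /= ?rmorph0 ?subrr //.
by rewrite subr0 /pA hv.
Qed.

Variable phi : {rmorphism symA R -> R}.
Hypothesis phi_pos : posK (coneT R) phi.

Lemma posK_scal c : phi (c *: 1) = c.
Proof. exact: (rmorph_realE (phi \o in_alg (symA R))). Qed.

Lemma coneT_Sigma f : Sigma R (inclA f) -> coneT R f.
Proof.
move=> sf; exists f => //; exists 0; last by rewrite addr0.
by exists 0 => //; rewrite mul0r.
Qed.

Lemma coneT_ideal f : idealI R f -> coneT R f.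
Proof.
move=> If; exists 0; last by exists f => //; rewrite add0r.
move=> n _; exists [::]; rewrite big_nil trunc_inclA.
by have [h [<- _ _]] := ceval_rmorphism (fun i => psum R n i.+2); rewrite rmorph0.
Qed.

Lemma posK_p2 : phi (pA R 0) = 1.
Proof.
have phi_ideal g : 0 <= phi (g * (1 - pA R 0)).
  by apply: phi_pos; apply: coneT_ideal; exists g.
move: (pA R 0) phi_ideal => p2 phi_ideal.
have := phi_ideal 1; have := phi_ideal (- 1).
rewrite mulN1r mul1r (rmorphN phi) oppr_ge0 (rmorphB phi) (rmorph1 phi) => le0 ge0.
by apply/eqP; rewrite eq_sym -subr_eq0 eq_le le0 ge0.
Qed.

Lemma posK_split N : exists2 s : seq R, size s = N &
  jensen_poly (phi \o e) N = \prod_(y <- s) ('X - y%:P).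
Proof.
have [monJ szJ] := @jensen_poly_monic R (phi \o e) N (map_newton phi newton_e).1.
apply: psd_bezout_split => // v.
have := phi_pos (coneT_Sigma (Sigma_bezout_form N v)).
congr (0 <= _); rewrite /bezout_form rmorph_sum; apply: eq_bigr => i _.
rewrite rmorph_sum; apply: eq_bigr => j _ /=.
by rewrite -map_jensen_poly map_bezout -mulr_algl rmorphM /= posK_scal.
Qed.

End Positivity.

(** * Limits *)

Section Limits.
Variable R : realType.

Lemma cvg_sumR (T I : Type) (G : set_system T) (r : seq I) (F : I -> T -> R) (l : I -> R) :
  Filter G -> (forall i, F i x @[x --> G] --> l i) ->
  \sum_(i <- r) F i x @[x --> G] --> \sum_(i <- r) l i.
Proof. by move=> FG Fl; apply: cvg_big => //; exact: add_continuous. Qed.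

Lemma cvg_prodR (T I : Type) (G : set_system T) (r : seq I) (F : I -> T -> R) (l : I -> R) :
  Filter G -> (forall i, F i x @[x --> G] --> l i) ->
  \prod_(i <- r) F i x @[x --> G] --> \prod_(i <- r) l i.
Proof. by move=> FG Fl; apply: cvg_big => //; exact: mul_continuous. Qed.

(** The power sum of index [j] is a polynomial in the [e k] and in the power
    sums of smaller index. *)
Lemma cvg_newton (E P : nat -> nat -> R) (e p : nat -> R) :
  (forall n, newton (E n) (P n)) -> newton e p ->
  (forall k, E n k @[n --> \oo] --> e k) ->
  forall j, P n j @[n --> \oo] --> p j.
Proof.
move=> NE Ne Ee j; elim/ltn_ind: j => j IHj.
have PE (e' p' : nat -> R) : newton e' p' -> p' j =
    (-1) ^+ j * (e' j.+1 *+ j.+1 - \sum_(i < j) (-1) ^+ i * p' i * e' (j - i)%N).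
  move=> [e'0 ->]; rewrite big_ord_recr /= subnn e'0 mulr1 addrAC subrr add0r.
  by rewrite mulrA -expr2 sqrr_sign mul1r.
rewrite (PE _ _ Ne); under eq_cvg => n do rewrite (PE _ _ (NE n)).
apply: cvgM; first exact: cvg_cst.
apply: cvgB; first exact: cvgMn.
apply: cvg_sumR => i; apply: cvgM; last exact: Ee.
by apply: cvgM; [exact: cvg_cst|exact: IHj].
Qed.

(** The polynomial [X^N - N (N - 1) / 2 X^(N-2) + ...] has roots of square sum
    [N (N - 1)]; this factor normalises them. *)
Definition root_scale (N : nat) : R := (Num.sqrt ((N * N.-1)%:R))^-1.

Lemma root_scale_sqr N : (1 < N)%N -> root_scale N ^+ 2 * (N * N.-1)%:R = 1.
Proof.
move=> N1; rewrite /root_scale exprVn sqr_sqrtr ?ler0n // mulVf //.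
by rewrite pnatr_eq0 muln_eq0 negb_or -!lt0n; case: N N1 => [|[]].
Qed.

(** Each of the [k] factors [(N - i) / sqrt (N (N - 1))] tends to [1]. *)
Lemma cvg_ffact_root_scale k : (n.+2 ^_ k)%:R * root_scale n.+2 ^+ k @[n --> \oo] --> (1 : R).
Proof.
have u1 : n.+2%:R * root_scale n.+2 @[n --> \oo] --> (1 : R).
  have -> : (fun n => n.+2%:R * root_scale n.+2) = (fun n => Num.sqrt (1 + harmonic n)) :> (nat -> R).
    apply/funext => n; rewrite /root_scale /harmonic /=.
    have n2 : 0 < n.+2%:R :> R by rewrite ltr0n.
    have n1 : 0 < n.+1%:R :> R by rewrite ltr0n.
    have -> : 1 + n.+1%:R^-1 = n.+2%:R ^+ 2 * (n.+2%:R * n.+1%:R)^-1 :> R.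
      have -> : n.+2%:R = n.+1%:R + 1 :> R by rewrite natr1.
      move: n.+1%:R n1 => y y0; field.
      by rewrite !lt0r_neq0 // addr_gt0.
    rewrite sqrtrM ?sqr_ge0 // sqrtr_sqr ger0_norm ?ltW // sqrtrV ?mulr_ge0 ?ltW //.
    by rewrite natrM.
  rewrite -[X in _ --> X]sqrtr1 -[X in Num.sqrt X](addr0 1).
  apply: (@cvg_comp _ _ _ (fun n => 1 + harmonic n : R) (@Num.sqrt R) _ (nbhs (1 + 0 : R)));
    last exact: sqrt_continuous.
  by apply: cvgD; [exact: cvg_cst|exact: cvg_harmonic].
have v0 i : i%:R * root_scale n.+2 @[n --> \oo] --> (0 : R).
  have -> : (fun n => i%:R * root_scale n.+2)
      = (fun n => (i%:R * (n.+2%:R * root_scale n.+2)) * harmonic n.+1) :> (nat -> R).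
    apply/funext => n; rewrite /harmonic /=.
    by rewrite -mulrA [_ * n.+2%:R^-1]mulrC mulKf // pnatr_eq0.
  rewrite -(mulr0 (i%:R * 1 : R)); apply: cvgM.
    by apply: cvgM; [exact: cvg_cst|exact: u1].
  by rewrite (cvg_shiftS (@harmonic R)); exact: cvg_harmonic.
elim: k => [|k IHk].
  by under eq_cvg => n do rewrite ffactn0 expr0 mulr1; exact: cvg_cst.
have -> : (fun n => (n.+2 ^_ k.+1)%:R * root_scale n.+2 ^+ k.+1) =
    (fun n => ((n.+2 ^_ k)%:R * root_scale n.+2 ^+ k) *
       (n.+2%:R * root_scale n.+2 - k%:R * root_scale n.+2)) :> (nat -> R).
  apply/funext => n; have -> : (n.+2 ^_ k.+1)%:R = (n.+2 ^_ k)%:R * (n.+2%:R - k%:R) :> R.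
    rewrite ffactnSr natrM; have [le_k|lt_k] := leqP k n.+2; first by rewrite natrB.
    by rewrite ffact_small ?mul0r.
  by rewrite exprS; ring.
by have := cvgM IHk (cvgB u1 (v0 k)); rewrite subr0 mulr1; apply.
Qed.

End Limits.

(** * Unit vectors *)

Section Points.
Variable R : realType.

Lemma peval_ord (x : finseq R) n k : (0 < k)%N ->
  (forall i, i \in finsupp x -> (i < n)%N) -> peval k x = \sum_(i < n) x i ^+ k.
Proof.
move=> k0 xn; rewrite /peval -(big_mkord xpredT (fun i => x i ^+ k)).
rewrite [RHS](bigID (mem (finsupp x))) /= [X in _ + X]big1 ?addr0 => [|i]; last first.
  by move/fsfun_dflt => ->; rewrite expr0n gtn_eqF.
rewrite -[RHS]big_filter; apply: perm_big; apply: uniq_perm.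
- exact: fset_uniq.
- by rewrite filter_uniq // iota_uniq.
move=> i; rewrite mem_filter mem_index_iota /=.
by apply/idP/andP => [ix|[]//]; split=> //; exact: xn.
Qed.

Definition finseq_of (s : seq R) : finseq R :=
  [fsfun i in seq_fset tt (iota 0 (size s)) => s`_i].

Lemma peval_finseq_of (s : seq R) k : (0 < k)%N ->
  peval k (finseq_of s) = \sum_(y <- s) y ^+ k.
Proof.
have sE i : finseq_of s i = s`_i.
  rewrite fsfun_fun seq_fsetE mem_iota add0n /=.
  by case: ltnP => // h; rewrite nth_default.
move=> k0; rewrite (@peval_ord _ (size s)) // => [|i].
  rewrite (big_nth 0) big_mkord; apply: eq_bigr => i _.
  by rewrite sE.
rewrite mem_finsupp sE; apply: contraNltn => h.
by rewrite nth_default.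
Qed.

Lemma norm2_eq1 (x : finseq R) : norm2 x = 1 <-> peval 2 x = 1.
Proof.
rewrite /norm2 -/(peval 2 x); split=> [h|->]; last exact: sqrtr1.
rewrite -[LHS]sqr_sqrtr ?h ?expr1n //.
by rewrite /peval sumr_ge0 // => i _; rewrite sqr_ge0.
Qed.
End Points.

Section Closure.
Variable R : realType.

(** Since [p_1 = 0] and [p_2 = 1], one has [e 1 = 0] and [e 2 = - 1 / 2]; the
    second Newton identity for the scaled roots then gives their square sum. *)
Lemma unit_points_of_split (e a : nat -> R) N (s : seq R) : (1 < N)%N ->
  newton e (pshift a) -> a 0 = 1 -> size s = N ->
  jensen_poly e N = \prod_(y <- s) ('X - y%:P) ->
  exists2 xs : seq R, \sum_(x <- xs) x ^+ 2 = 1 &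
    forall k, (esym_gf xs)`_k = e k * ((N ^_ k)%:R * root_scale R N ^+ k).
Proof.
move=> N1 [e0 eS] a0 sN Js.
pose xs := [seq - root_scale R N * y | y <- s].
have coefE k : (esym_gf xs)`_k = e k * ((N ^_ k)%:R * root_scale R N ^+ k).
  have [le_k|lt_k] := leqP k N.
    rewrite -coef_prod_XsubC_esym ?sN // -Js coef_poly ltnS leq_subr subKn //.
    by rewrite mulr_natl mulrnAr mulrnAl.
  rewrite nth_default ?ffact_small ?mul0r ?mulr0 //.
  by rewrite (leq_trans (size_esym_gf _)) // size_map sN.
exists xs => //.
have [_ qS] := newton_esym_gf xs.
have e1 : e 1 = 0 by have := eS 0; rewrite big_ord1 mulr0 mul0r mulr1n.
have e2 : e 2 *+ 2 = - 1.
  have := eS 1; rewrite big_ord_recl big_ord1 mulr0 mul0r add0r /= => ->.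
  by rewrite a0 e0 expr1 !mulr1.
have := qS 1; rewrite big_ord_recl big_ord1 /=.
have -> : (esym_gf xs)`_1 = 0 by rewrite coefE e1 mul0r.
have -> : (esym_gf xs)`_(1 - 1) = 1 by rewrite subnn (newton_esym_gf xs).1.
rewrite mulr0 add0r mulr1 expr1 mulN1r.
rewrite (coefE 2) -mulrnAl e2 [_%:R * _]mulrC.
have -> : (N ^_ 2 = N * N.-1)%N by rewrite ffactnS ffactn1.
by rewrite root_scale_sqr // mulr1 => /oppr_inj.
Qed.

Lemma posK_closure (phi : {rmorphism symA R -> R}) : posK (coneT R) phi ->
  closure ([set (fun i : nat => peval i.+2 x) |
              x in [set x : finseq R | norm2 x = 1]] : set {ptws nat -> R})
    (fun i => phi (pA R i)).
Proof.
move=> phi_pos; pose a (i : nat) : R := phi (pA R i); rewrite -/a.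
have [e ne] := newton_ex (pshift (pA R)).
have nphi : newton (phi \o e) (pshift a).
  have := map_newton phi ne.
  suff -> : phi \o pshift (pA R) = pshift a by [].
  by apply/funext => -[|j] //=; rewrite rmorph0.
have a0 : a 0 = 1 := posK_p2 phi_pos.
have xsP n : {xs : seq R | \sum_(x <- xs) x ^+ 2 = 1 &
    forall k, (esym_gf xs)`_k = (phi \o e) k * ((n.+2 ^_ k)%:R * root_scale R n.+2 ^+ k)}.
  apply: cid2; have [s sN Js] := posK_split ne phi_pos n.+2.
  exact (unit_points_of_split (isT : (1 < n.+2)%N) nphi a0 sN Js).
pose xs n := s2val (xsP n).
have cvg_p j : \sum_(x <- xs n) x ^+ j.+1 @[n --> \oo] --> pshift a j.
  apply: (cvg_newton (fun n => newton_esym_gf (xs n)) nphi) => k.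
  under eq_cvg => n do rewrite (s2valP' (xsP n)).
  have := cvgM (cvg_cst ((phi \o e) k)) (@cvg_ffact_root_scale R k).
  by rewrite mulr1; apply.
pose u n := (fun i : nat => peval i.+2 (finseq_of (xs n))) : {ptws nat -> R}.
have cvg_u : u n @[n --> \oo] --> (a : {ptws nat -> R}).
  apply/pointwise_cvgP => i.
  have uE : (fun n => u n i) = (fun n => \sum_(x <- xs n) x ^+ i.+2).
    by apply/funext => n; rewrite /u peval_finseq_of.
  by have := cvg_p i.+1; rewrite -uE.
move=> B /cvg_u [n _ /(_ n (leqnn n)) uB]; exists (u n); split=> //.
exists (finseq_of (xs n)) => //=.
by apply/norm2_eq1; rewrite peval_finseq_of // (s2valP (xsP n)).
Qed.

(** * Evaluation at the points of the closure *)

Lemma ceval_continuous f (a : {ptws nat -> R}) :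
  (ceval (S := R^o) b f : R) @[b --> nbhs a] --> (ceval (S := R^o) a f : R).
Proof.
pose F (m : cmonom nat) (b : {ptws nat -> R}) : R :=
  monalg.mcoeff m f * \prod_(i <- finsupp m) b i ^+ m i.
have cevalE (b : {ptws nat -> R}) : (ceval (S := R^o) b f : R) = \sum_(m <- monalg.msupp f) F m b.
  rewrite /ceval /monalg.mmap; apply: eq_bigr => m _.
  by rewrite /= [_%:A](mulr1 (monalg.mcoeff m f)).
have -> : (fun b : {ptws nat -> R} => ceval (S := R^o) b f : R) =
    (fun b => \sum_(m <- monalg.msupp f) F m b) by apply/funext.
rewrite cevalE.
have Fcont m : F m b @[b --> nbhs a] --> F m a.
  apply: cvgM; first exact: cvg_cst.
  apply: cvg_prodR => i.
  have pr : b i @[b --> nbhs a] --> a i.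
    by have /pointwise_cvgP := (@cvg_id _ (nbhs a)); apply.
  apply: (@cvg_comp _ _ _ (fun b : {ptws nat -> R} => b i) (fun y : R => y ^+ m i)
    (nbhs a) (nbhs (a i)) _ pr).
  exact: exprn_continuous.
exact: (@cvg_sumR R _ _ (nbhs a) (monalg.msupp f) F (F^~ a) _ Fcont).
Qed.

Lemma Sigma_peval_ge0 f (x : finseq R) : Sigma R (inclA f) ->
  0 <= ceval (S := R^o) (fun i => peval i.+2 x) f.
Proof.
move=> sf.
pose n := (\max_(i <- finsupp x) i)%N.+1.
have xn i : i \in finsupp x -> (i < n)%N.
  by move=> ix; rewrite ltnS; exact: (leq_bigmax_seq (F := id)).
have [s fs] := sf n isT.
pose h : {rmorphism mpoly n R -> R^o} := mpoly.meval (fun i => x i).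
have hc (c : R) : h (c *: 1) = c *: 1.
  exact (etrans (mevalZ _ c 1) (congr1 _ (rmorph1 h))).
have -> : ceval (S := R^o) (fun i => peval i.+2 x) f = h (trunc n (inclA f)).
  rewrite trunc_inclA rmorph_comp_ceval //; congr (ceval _ f); apply/funext => i /=.
  rewrite (peval_ord _ xn) // /psum rmorph_sum; apply: eq_bigr => j _.
  by rewrite rmorphXn /= mevalXU.
rewrite fs rmorph_sum sumr_ge0 // => g _.
by rewrite rmorphXn sqr_ge0.
Qed.

Lemma closure_posK (a : {ptws nat -> R}) :
  closure ([set (fun i : nat => peval i.+2 x) |
              x in [set x : finseq R | norm2 x = 1]] : set {ptws nat -> R}) a ->
  exists2 phi : {rmorphism symA R -> R}, posK (coneT R) phi & (fun i => phi (pA R i)) = a.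
Proof.
move=> cla; have [h [hE hc hv]] := ceval_rmorphism (S := R^o) a.
exists h; last by apply/funext => i; exact: hv.
move=> f Tf; rewrite leNgt; apply/negP => f_lt0.
have a_lt0 : (ceval (S := R^o) a f : R) < 0 by rewrite -(hE f).
have nb := cvgr_lt (ceval (S := R^o) a f : R) (@ceval_continuous f a) (0 : R) a_lt0.
have [b [[x x1 <-]]] := cla _ (nb (nbhs_filter a)).
apply/negP; rewrite -leNgt.
have [hb [hbE hbc hbv]] := ceval_rmorphism (S := R^o) (fun i => peval i.+2 x).
rewrite -(hbE f).
case: Tf => s sS [_ [g _ <-] <-].
have : hb (pA R 0) = 1 by rewrite hbv; apply/norm2_eq1.
move: (pA R 0) => p2 hp2.
rewrite (rmorphD hb) (rmorphM hb) (rmorphB hb) (rmorph1 hb) hp2 subrr mulr0 addr0 hbE.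
exact: Sigma_peval_ge0.
Qed.
End Closure.

Theorem corollary4p7 (R : realType) :
  [set (fun i : nat => phi (pA R i)) | phi in posK (coneT R)]
  = closure ([set (fun i : nat => peval i.+2 x) |
              x in [set x : finseq R | norm2 x = 1]] : set {ptws nat -> R}).
Proof.
apply/seteqP; split=> [_ [phi phi_pos <-]|a]; first exact: posK_closure.
by move=> /closure_posK [phi phi_pos <-]; exists phi.
Qed.
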